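(* Let $n\ge2$ and let $V=\mathbb{C}^{\{1,\dots,n\}}$ be the defining permutation representation of $S_n$. Consider the coset identification problem for the subgroup $A_n\le S_n$, i.e. determining the sign of a hidden uniformly random permutation $a\in S_n$ given oracle access to its permutation matrix. Then there is a $t$-query quantum algorithm succeeding with probability $1$ for $t=\lfloor n/2\rfloor$, while for every $t<\lfloor n/2\rfloor$ the optimal $t$-query success probability is exactly $1/2$.
   Context: A $t$-query algorithm consists of $N\ge1$, unit vector $\psi\in V\otimes\mathbb{C}^N$, unitaries $U_1,\dots,U_t$ on $V\otimes\mathbb{C}^N$ and a two-outcome POVM $\{E_{+1},E_{-1}\}$; on hidden $a$ it produces $\psi_a=U_t(\pi(a)\otimes I)\cdots U_1(\pi(a)\otimes I)\psi$ where $\pi(a)$ is the permutation matrix of $a$; success probability is $\frac1{n!}\sum_{a\in S_n}\langle\psi_a|E_{\mathrm{sgn}(a)}|\psi_a\rangle$. *)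

(* Defs.v *)
From HB Require Import structures.
From mathcomp Require Import all_boot all_order all_algebra all_fingroup.
Set Implicit Arguments. Unset Strict Implicit. Unset Printing Implicit Defensive.
Import Order.TTheory GRing.Theory Num.Theory.
Local Open Scope ring_scope.

(* Splitting an index of V (x) C^N = C^(n*N) as (i, j) with k = i*N + j. *)
Lemma tens_div_ord n N (k : 'I_(n * N)) : (k %/ N < n)%N.
Proof.
case: N k => [|N] k; first by case: k => m; rewrite muln0.
by rewrite ltn_divLR // ltn_ord.
Qed.

Lemma tens_mod_ord n N (k : 'I_(n * N)) : (k %% N < N)%N.
Proof.
case: N k => [|N] k; first by case: k => m; rewrite muln0.
by rewrite ltn_pmod.
Qed.

Definition tens_fst n N (k : 'I_(n * N)) : 'I_n := Ordinal (tens_div_ord k).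
Definition tens_snd n N (k : 'I_(n * N)) : 'I_N := Ordinal (tens_mod_ord k).

Definition kron (R : pzRingType) n N (A : 'M[R]_n) (B : 'M[R]_N) : 'M[R]_(n * N) :=
  \matrix_(k, l) (A (tens_fst k) (tens_fst l) * B (tens_snd k) (tens_snd l)).

Section Quantum.
Variable C : numClosedFieldType.

Definition adjmx m p (A : 'M[C]_(m, p)) : 'M[C]_(p, m) := (map_mx Num.conj A)^T.

Definition unitary m (U : 'M[C]_m) : Prop := U *m adjmx U = 1%:M.

Definition unit_vec m (v : 'cV[C]_m) : Prop := (adjmx v *m v) 0 0 = 1.

(* positive semidefinite: <v|E|v> >= 0 (real and nonnegative) for all v *)
Definition psd m (E : 'M[C]_m) : Prop := forall v : 'cV[C]_m, 0 <= (adjmx v *m E *m v) 0 0.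

Definition two_povm m (Ep Em : 'M[C]_m) : Prop := psd Ep /\ psd Em /\ Ep + Em = 1%:M.

(* psi_a = U_t (pi(a) (x) I) ... U_1 (pi(a) (x) I) psi ; U_1,...,U_t are U 0,...,U (t-1) *)
Fixpoint run n N (U : nat -> 'M[C]_(n * N)) (P : 'M[C]_(n * N)) (psi : 'cV[C]_(n * N))
  (k : nat) : 'cV[C]_(n * N) :=
  match k with
  | 0 => psi
  | k'.+1 => U k' *m (P *m run U P psi k')
  end.

Definition is_query_alg n t N (psi : 'cV[C]_(n * N)) (U : nat -> 'M[C]_(n * N))
  (Ep Em : 'M[C]_(n * N)) : Prop :=
  (0 < N)%N /\ unit_vec psi /\ (forall i, (i < t)%N -> unitary (U i)) /\ two_povm Ep Em.

Definition state_of n t N (psi : 'cV[C]_(n * N)) (U : nat -> 'M[C]_(n * N)) (a : 'S_n)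
  : 'cV[C]_(n * N) := run U (kron (perm_mx a) (1%:M : 'M[C]_N)) psi t.

Definition success n t N (psi : 'cV[C]_(n * N)) (U : nat -> 'M[C]_(n * N))
  (Ep Em : 'M[C]_(n * N)) : C :=
  (n`!%:R)^-1 * \sum_(a : 'S_n)
     (adjmx (state_of t psi U a) *m (if odd_perm a then Em else Ep)
        *m state_of t psi U a) 0 0.
End Quantum.

(* Main.v *)
(* Lower bound.  Every entry of psi_a psi_a^* is a combination of products of at
   most 2t indicators [a(i) = j].  For 2t <= n - 2 such a product is unchanged when a
   is composed with a transposition of two points that it does not inspect, so its
   sum against sgn(a) vanishes, and every t-query algorithm succeeds with
   probability exactly 1/2.

   Upper bound.  Let t = n./2 and let w_1, ..., w_t be an orthonormal family spanning
   a totally isotropic subspace, for the bilinear form x^T y, of V (n = 2t) or of the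
   orthogonal complement of the constant vector u (n = 2t + 1).  Apply pi(a) in
   parallel to the t factors of w_1 /\ ... /\ w_t.  The overlap of the states for a
   and b is the minor det(W^* g W) with g = a^-1 b.  In the orthonormal basis formed
   by the w_i, their conjugates and possibly u, Jacobi's identity on complementary
   minors gives det(W^* g W) = det(g) det(W^* g W).  Hence the states for even a are
   orthogonal to those for odd b, and a projective measurement separates them. *)
Require Import Defs.
From HB Require Import structures.
From mathcomp Require Import all_boot all_order all_algebra all_fingroup.
From mathcomp Require Import cyclic separable cyclotomic zify ring.
Set Implicit Arguments. Unset Strict Implicit. Unset Printing Implicit Defensive.
Import Order.TTheory GRing.Theory Num.Theory.
Local Open Scope ring_scope.

(** * Indices of the tensor product *)

Lemma tens_idx_ord n N (i : 'I_n) (j : 'I_N) : (i * N + j < n * N)%N.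
Proof.
apply: (@leq_trans (i.+1 * N)); last by rewrite leq_mul2r ltn_ord orbT.
by rewrite mulSn addnC ltn_add2r.
Qed.

Definition tens_idx n N (i : 'I_n) (j : 'I_N) : 'I_(n * N) :=
  Ordinal (tens_idx_ord i j).

Lemma tens_fstK n N (i : 'I_n) (j : 'I_N) : tens_fst (tens_idx i j) = i.
Proof.
apply: val_inj => /=; have N0 : (0 < N)%N := leq_ltn_trans (leq0n _) (ltn_ord j).
by rewrite divnMDl // divn_small ?addn0.
Qed.

Lemma tens_sndK n N (i : 'I_n) (j : 'I_N) : tens_snd (tens_idx i j) = j.
Proof. by apply: val_inj => /=; rewrite modnMDl modn_small. Qed.

Lemma tens_idxK n N (k : 'I_(n * N)) : tens_idx (tens_fst k) (tens_snd k) = k.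
Proof. by apply: val_inj => /=; rewrite -divn_eq. Qed.

Lemma tens_act_inj n N (a : 'S_n) :
  injective (fun k : 'I_(n * N) => tens_idx (a (tens_fst k)) (tens_snd k)).
Proof.
move=> k l kl; rewrite -(tens_idxK k) -(tens_idxK l); congr tens_idx.
  by apply: (@perm_inj _ a); move/(congr1 (@tens_fst n N)): kl; rewrite !tens_fstK.
by move/(congr1 (@tens_snd n N)): kl; rewrite !tens_sndK.
Qed.

Definition tens_perm n N (a : 'S_n) : 'S_(n * N) := perm (@tens_act_inj n N a).

(** * Adjoints, unitarity and positivity *)

Section Adjoint.
Variable C : numClosedFieldType.

Lemma adjmxE m p (A : 'M[C]_(m, p)) i j : adjmx A i j = (A j i)^*.
Proof. by rewrite !mxE. Qed.

Lemma adjmx_mul m n p (A : 'M[C]_(m, n)) (B : 'M[C]_(n, p)) :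
  adjmx (A *m B) = adjmx B *m adjmx A.
Proof. by rewrite /adjmx map_mxM trmx_mul. Qed.

Lemma adjmxK m n (A : 'M[C]_(m, n)) : adjmx (adjmx A) = A.
Proof. by apply/matrixP => i j; rewrite !adjmxE conjCK. Qed.

Lemma adjmx1 n : adjmx 1%:M = 1%:M :> 'M[C]_n.
Proof. by rewrite /adjmx map_mx1 trmx1. Qed.

Lemma adjmxB m n (A B : 'M[C]_(m, n)) : adjmx (A - B) = adjmx A - adjmx B.
Proof. by apply/matrixP => i j; rewrite !mxE rmorphB. Qed.

Lemma adjmx0 m n : adjmx 0 = 0 :> 'M[C]_(m, n).
Proof. by apply/matrixP => i j; rewrite !mxE rmorph0. Qed.

Lemma adjmx_perm n (s : 'S_n) : adjmx (perm_mx s : 'M[C]_n) = perm_mx s^-1.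
Proof. by rewrite /adjmx map_perm_mx tr_perm_mx. Qed.

Lemma unitary_perm n (s : 'S_n) : unitary (perm_mx s : 'M[C]_n).
Proof. by rewrite /unitary adjmx_perm -perm_mxM mulgV perm_mx1. Qed.

Lemma unitary1 n : unitary (1%:M : 'M[C]_n).
Proof. by rewrite /unitary adjmx1 mulmx1. Qed.

Lemma unitary_norm n (U : 'M[C]_n) (v : 'cV[C]_n) :
  unitary U -> adjmx (U *m v) *m (U *m v) = adjmx v *m v.
Proof.
by move=> /mulmx1C UU; rewrite adjmx_mul -mulmxA (mulmxA (adjmx U)) UU mul1mx.
Qed.

Lemma psd_adj_mul m p (A : 'M[C]_(m, p)) : psd (adjmx A *m A).
Proof.
move=> v; rewrite mulmxA -adjmx_mul -mulmxA mxE; apply: sumr_ge0 => i _.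
by rewrite adjmxE mulrC -normCK exprn_ge0.
Qed.

Lemma psd1 m : psd (1%:M : 'M[C]_m).
Proof. by have := @psd_adj_mul _ _ (1%:M : 'M[C]_m); rewrite adjmx1 mulmx1. Qed.

Lemma psd0 m : psd (0 : 'M[C]_m).
Proof. by move=> v; rewrite mulmx0 mul0mx mxE. Qed.

Lemma perm_mx_mulE n p (s : 'S_n) (A : 'M[C]_(n, p)) i j :
  (perm_mx s *m A) i j = A (s i) j.
Proof. by rewrite -row_permE mxE. Qed.

(** The oracle permutes the basis vectors, so its action can be followed on indices. *)
Lemma kron_perm n N (a : 'S_n) :
  kron (perm_mx a) (1%:M : 'M[C]_N) = perm_mx (tens_perm N a).
Proof.
apply/matrixP => k l; rewrite !mxE permE -natrM mulnb; congr (nat_of_bool _)%:R.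
apply/andP/eqP => [[/eqP-> /eqP->]|<-]; first exact: tens_idxK.
by rewrite tens_fstK tens_sndK.
Qed.

Lemma unitary_kron_perm n N (a : 'S_n) :
  unitary (kron (perm_mx a) (1%:M : 'M[C]_N)).
Proof. by rewrite kron_perm; apply: unitary_perm. Qed.

Lemma run_norm n N (U : nat -> 'M[C]_(n * N)) P psi t :
  (forall i, (i < t)%N -> unitary (U i)) -> unitary P ->
  adjmx (run U P psi t) *m run U P psi t = adjmx psi *m psi.
Proof.
move=> Uu Pu; elim: t Uu => //= t IH Uu.
rewrite !unitary_norm ?IH //; last exact: Uu.
by move=> i it; apply: Uu; apply: ltnW.
Qed.

End Adjoint.

(** * Lower bound: cancellation against the sign *)

Section LowerBound.
Variables (C : numClosedFieldType) (n : nat).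
Implicit Types (S : {set 'I_n}) (g : 'S_n -> C).

(** In [tperm x y * a] the transposition acts first, so the condition means that [g] sees [a] only
    through its values on [S]. *)
Definition determined_on S g :=
  forall x y (a : 'S_n), x \notin S -> y \notin S -> g (tperm x y * a)%g = g a.

Lemma determined_on_mul S i g h :
  determined_on S g -> determined_on [set i] h ->
  determined_on (i |: S) (fun a => h a * g a).
Proof.
move=> gS hi x y a; rewrite !inE !negb_or => /andP[xi xS] /andP[yi yS].
by rewrite gS // hi // inE.
Qed.

Lemma determined_on_kron N (k l : 'I_(n * N)) :
  determined_on [set tens_fst k] (fun a => kron (perm_mx a) (1%:M : 'M[C]_N) k l).
Proof.
move=> x y a; rewrite !inE => xk yk.
by rewrite !mxE permM tpermD.
Qed.

(** Two points lie outside [S]; composing with their transposition preserves [g] and flips the sign,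
    so the sum is its own negative. *)
Lemma sum_sign_determined S g : (#|S| + 2 <= n)%N -> determined_on S g ->
  \sum_(a : 'S_n) (-1) ^+ odd_perm a * g a = 0.
Proof.
move=> Sn gS.
have /card_gt1P[x [y [xS yS xy]]] : (1 < #|~: S|)%N.
  by rewrite -(leq_add2l #|S|) cardsC card_ord.
rewrite !inE in xS yS.
apply/eqP; rewrite -[_ == 0](mulrn_eq0 _ 2) mulr2n addr_eq0; apply/eqP.
rewrite {1}(reindex_inj (mulgI (tperm x y))) -sumrN; apply: eq_bigr => a _.
by rewrite odd_mul_tperm xy gS // signr_addb expr1 mulN1r mulNr.
Qed.

(** [g] accumulates the oracle entries met so far and [S] the points they inspect. Each induction
    step peels one query off one of the two states and adds at most one point to [S]; once no query
    is left, the amplitudes do not depend on [a]. *)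
Lemma sum_sign_amplitudes N (U : nat -> 'M[C]_(n * N)) psi t t' k l S g :
  (#|S| + t + t' + 2 <= n)%N -> determined_on S g ->
  \sum_(a : 'S_n) (-1) ^+ odd_perm a *
     (g a * (state_of t psi U a k 0)^* * state_of t' psi U a l 0) = 0.
Proof.
have cardU1 i S1 : (#|i |: S1| <= #|S1|.+1)%N by rewrite cardsU1 -addn1 addnC leq_add2l leq_b1.
have shuffle1 (s x y u p z : C) : s * (x * y * (u * (p * z))) = u * (s * (p * x * y * z)).
  by ring.
have shuffle2 (s x u p y z : C) : s * (x * (u * (p * y)) * z) = u * (s * (p * x * y * z)).
  by ring.
elim: t k S g => [|t IHt] k S g.
  elim: t' l S g => [|t' IHt'] l S g /= tn gS.
    rewrite /state_of /=; under eq_bigr do rewrite -mulrA [g _ * _]mulrC mulrCA.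
    rewrite -mulr_sumr (@sum_sign_determined S) ?mulr0 //.
    by rewrite !addn0 in tn.
  rewrite /state_of /=.
  under eq_bigr => a _.
    rewrite mxE mulr_sumr mulr_sumr.
    under eq_bigr => j _ do rewrite mxE !mulr_sumr.
    over.
  rewrite exchange_big big1 //= => j _; rewrite exchange_big big1 //= => j' _.
  set i := tens_fst j.
  under eq_bigr => a _.
    rewrite shuffle1.
    over.
  (* The entry of [U] is constant in [a] and leaves the sum; the oracle entry joins [g] at the cost
     of the point [i]. *)
  rewrite -mulr_sumr (IHt' _ (i |: S)) ?mulr0 //; last first.
    exact/determined_on_mul/determined_on_kron.
  move: (cardU1 i S) tn; move: #|i |: S| #|S| => c c0; lia.
move=> tn gS.
rewrite {1}/state_of /=.
under eq_bigr => a _.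
  rewrite mxE rmorph_sum mulr_sumr mulr_suml mulr_sumr.
  under eq_bigr => j _ do rewrite mxE rmorphM rmorph_sum /= !mulr_sumr mulr_suml mulr_sumr.
  over.
rewrite exchange_big big1 //= => j _; rewrite exchange_big big1 //= => j' _.
set i := tens_fst j.
under eq_bigr => a _.
  (* Oracle entries are 0 or 1, hence fixed by conjugation. *)
  have conjk : (kron (perm_mx a) (1%:M : 'M[C]_N) j j')^* = kron (perm_mx a) 1%:M j j'.
    by rewrite kron_perm !mxE rmorph_nat.
  rewrite rmorphM /= conjk shuffle2.
  over.
rewrite -mulr_sumr (IHt _ (i |: S)) ?mulr0 //; last first.
  exact/determined_on_mul/determined_on_kron.
move: (cardU1 i S) tn; move: #|i |: S| #|S| => c c0; lia.
Qed.

Lemma sum_sign_form N (U : nat -> 'M[C]_(n * N)) psi t (E : 'M[C]_(n * N)) :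
  (t < n./2)%N ->
  \sum_(a : 'S_n) (-1) ^+ odd_perm a *
     (adjmx (state_of t psi U a) *m E *m state_of t psi U a) 0 0 = 0.
Proof.
move=> tn.
have shuffle (s x y z : C) : s * (x * y * z) = s * (1 * x * z) * y by ring.
under eq_bigr => a _.
  rewrite mxE mulr_sumr.
  under eq_bigr => l _ do rewrite mxE mulr_suml mulr_sumr.
  over.
rewrite exchange_big big1 //= => l _; rewrite exchange_big big1 //= => k _.
under eq_bigr => a _.
  rewrite adjmxE shuffle.
  over.
rewrite -mulr_suml (@sum_sign_amplitudes _ _ _ _ _ _ _ set0 (fun=> 1)) ?mul0r //.
rewrite cards0; lia.
Qed.

Lemma success_half N (U : nat -> 'M[C]_(n * N)) psi t (Ep Em : 'M[C]_(n * N)) :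
  (t < n./2)%N -> is_query_alg t psi U Ep Em -> success t psi U Ep Em = 2^-1.
Proof.
move=> tn [N0 [psi1 [Uu [_ [_ EE]]]]].
have n0 : (n`!%:R : C) != 0 by rewrite pnatr_eq0 -lt0n fact_gt0.
rewrite /success.
suff -> : \sum_(a : 'S_n) (adjmx (state_of t psi U a) *m (if odd_perm a then Em else Ep)
        *m state_of t psi U a) 0 0 = 2^-1 * n`!%:R.
  by rewrite mulrCA mulVf // mulr1.
pose F (E : 'M[C]_(n * N)) a := (adjmx (state_of t psi U a) *m E *m state_of t psi U a) 0 0.
have FD a E E' : F (E + E') a = F E a + F E' a.
  by rewrite /F mulmxDr mulmxDl mxE.
have F1 a : F Ep a + F Em a = 1.
  rewrite -FD EE /F mulmx1 /state_of run_norm //; exact: unitary_kron_perm.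
(* By [F1] the outcome probabilities p, q satisfy p = (1 + (p - q)) / 2; the sign of [a] selects
   which of the two is the correct answer. *)
rewrite (eq_bigr (fun a => 2^-1 * (1 + ((-1) ^+ odd_perm a * F Ep a - (-1) ^+ odd_perm a * F Em a)))); last first.
  move=> a _; rewrite -/(F _ a) -[X in _ * (X + _)](F1 a).
  by case: (odd_perm a); rewrite ?expr1 ?expr0; field.
rewrite -mulr_sumr big_split /= sumrB !sum_sign_form // subr0 addr0.
by rewrite sumr_const card_Sn.
Qed.

End LowerBound.

(** * Isotropic frames and complementary minors *)

Section Isotropic.
Variable C : numClosedFieldType.

Lemma adjmx_row m p q (A : 'M[C]_(m, p)) (B : 'M[C]_(m, q)) :
  adjmx (row_mx A B) = col_mx (adjmx A) (adjmx B).
Proof. by rewrite /adjmx map_row_mx tr_row_mx. Qed.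

Lemma adjmx_conj m p (A : 'M[C]_(m, p)) : adjmx (map_mx Num.conj A) = A^T.
Proof. by apply/matrixP => i j; rewrite !mxE conjCK. Qed.

Lemma trmx_conj m p (A : 'M[C]_(m, p)) : (adjmx A)^T = map_mx Num.conj A.
Proof. by rewrite /adjmx trmxK. Qed.

(** The hypothesis [W^T *m Y = 0] makes [W] orthogonal to the conjugate [X] of [Y], so together they
    form a unitary [B]. Jacobi's identity in this basis relates the [W] block of [g] to the [X]
    block of its inverse, which is the transpose of the compression of [g] to [Y]. *)
Lemma det_compress t r (W : 'M[C]_(t + r, t)) (Y : 'M[C]_(t + r, r)) (g : 'S_(t + r)) :
    adjmx W *m W = 1%:M -> adjmx Y *m Y = 1%:M -> W^T *m Y = 0 ->
  \det (adjmx W *m perm_mx g *m W) =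
    (-1) ^+ odd_perm g * \det (adjmx Y *m perm_mx g *m Y).
Proof.
move=> WW YY WY; set X := map_mx Num.conj Y; pose B := row_mx W X.
pose P := perm_mx g : 'M[C]_(t + r).
have conjP : map_mx Num.conj P = P by rewrite map_perm_mx.
have XX : adjmx X *m X = 1%:M.
  by rewrite adjmx_conj -[RHS]trmx1 -YY trmx_mul trmx_conj.
have WX : adjmx W *m X = 0.
  apply: (can_inj (@adjmxK _ _ _)); rewrite adjmx_mul adjmxK adjmx_conj adjmx0.
  by rewrite -[RHS]trmx0 -WY trmx_mul trmxK.
have XW : adjmx X *m W = 0 by rewrite -[LHS]adjmxK adjmx_mul adjmxK WX adjmx0.
have BB : adjmx B *m B = 1%:M.
  by rewrite adjmx_row mul_col_row WW XX WX XW -scalar_mx_block.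
have PP : P *m P^T = 1%:M by rewrite tr_perm_mx -perm_mxM mulgV perm_mx1.
have blockE (A : 'M[C]_(t + r)) : adjmx B *m A *m B =
    block_mx (adjmx W *m A *m W) (adjmx W *m A *m X)
             (adjmx X *m A *m W) (adjmx X *m A *m X).
  by rewrite adjmx_row mul_col_mx mul_col_row.
have GH : (adjmx B *m P *m B) *m (adjmx B *m P^T *m B) = 1%:M.
  rewrite !mulmxA -(mulmxA _ B) (mulmx1C BB) mulmx1 -(mulmxA _ P) PP mulmx1.
  exact: BB.
have detG : \det (adjmx B *m P *m B) = (-1) ^+ odd_perm g.
  by rewrite !det_mulmx mulrAC -det_mulmx BB det1 mul1r det_perm.
have detH : \det (adjmx X *m P^T *m X) = \det (adjmx Y *m P *m Y).
  by rewrite -[RHS]det_tr !trmx_mul trmx_conj adjmx_conj mulmxA.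
rewrite -/P -detG -detH; move: GH; rewrite !blockE.
set G11 := adjmx W *m P *m W; set G12 := _ *m _ *m X; set G21 := _ *m _ *m W.
set G22 := _ *m _ *m X; set H11 := _ *m _ *m W; set H12 := adjmx W *m _ *m X.
set H21 := adjmx X *m _ *m W; set H22 := adjmx X *m P^T *m X.
rewrite mulmx_block scalar_mx_block => /eq_block_mx[_ E12 _ E22].
(* Multiplying the matrix of [g] by the identity whose last [r] columns are replaced by those of the
   inverse gives this block triangular matrix. *)
transitivity (\det (block_mx G11 0 G21 (1%:M : 'M_r))).
  by rewrite det_lblock det1 mulr1.
rewrite -[\det H22]mul1r -[X in X * \det H22](det1 C t) -(det_ublock _ H12) -det_mulmx.
by rewrite mulmx_block !mulmx0 !mulmx1 !addr0 E12 E22.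
Qed.

Lemma odd_det_compress t r (W : 'M[C]_(t + r, t)) (Y : 'M[C]_(t + r, r)) (g : 'S_(t + r)) :
    adjmx W *m W = 1%:M -> adjmx Y *m Y = 1%:M -> W^T *m Y = 0 ->
    \det (adjmx Y *m perm_mx g *m Y) = \det (adjmx W *m perm_mx g *m W) ->
  odd_perm g -> \det (adjmx W *m perm_mx g *m W) = 0.
Proof.
move=> WW YY WY detY g1; have := det_compress g WW YY WY.
rewrite detY g1 expr1 mulN1r => /eqP; rewrite -addr_eq0 -mulr2n.
by rewrite mulrn_eq0 => /eqP.
Qed.

(** The determinant is the overlap of the exterior product of the columns of [W] with its image
    under [g]; its vanishing for odd [g] makes states of opposite sign orthogonal. *)
Definition sign_separating n t (W : 'M[C]_(n, t)) := adjmx W *m W = 1%:M /\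
  forall g : 'S_n, odd_perm g -> \det (adjmx W *m perm_mx g *m W) = 0.

Lemma sqrtC_nat_inv m : (0 < m)%N ->
  exists s : C, s^* = s /\ s ^+ 2 * m%:R = 1.
Proof.
move=> m0; exists (sqrtC m%:R)^-1; split.
  by rewrite geC0_conj // invr_ge0 sqrtC_ge0 ler0n.
by rewrite exprVn sqrtCK mulVf // pnatr_eq0 -lt0n.
Qed.

(** The columns (e_k + i e_{t+k}) / sqrt 2 are orthonormal, and isotropic because 1 + i^2 = 0, so
    [W] itself can serve as [Y]. *)
Lemma sign_separating_even t : exists W : 'M[C]_(t + t, t), sign_separating W.
Proof.
have [s [sc s2]] := @sqrtC_nat_inv 2 isT.
have ii : 'i * 'i = -1 :> C by rewrite -expr2 sqrCi.
pose W : 'M[C]_(t + t, t) := s *: col_mx 1%:M ('i *: 1%:M).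
have WW : adjmx W *m W = 1%:M.
  have -> : adjmx W = s *: row_mx 1%:M (- 'i *: 1%:M).
    rewrite /adjmx map_mxZ map_col_mx map_mxZ map_mx1 linearZ /= tr_col_mx linearZ /=.
    by rewrite !trmx1 sc conjCi.
  rewrite -scalemxAl -scalemxAr mul_row_col -scalemxAl -scalemxAr !mul1mx !scalerA.
  rewrite -[X in X + _]scale1r -scalerDl scalerA mulNr ii opprK.
  by rewrite -expr2 s2 scale1r.
have WTW : W^T *m W = 0.
  have -> : W^T = s *: row_mx 1%:M ('i *: 1%:M).
    by rewrite linearZ /= tr_col_mx linearZ /= trmx1.
  rewrite -scalemxAl -scalemxAr mul_row_col -scalemxAl -scalemxAr !mul1mx !scalerA.
  rewrite -[X in X + _]scale1r -scalerDl scalerA ii subrr.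
  by rewrite mulr0 scale0r.
exists W; split=> // g; exact: (odd_det_compress WW WW WTW erefl).
Qed.

(** In characteristic 0 the polynomial X^n - 1 is separable, and [n] distinct [n]-th roots of unity
    include a primitive one. *)
Lemma prim_root_exists n : (0 < n)%N -> exists z : C, n.-primitive_root z.
Proof.
move=> n_gt0; pose p : {poly C} := 'X^n - 1; have [r Dp] := closed_field_poly_normal p.
rewrite (monicP _) ?monicXnsubC // scale1r in Dp.
have rn1 : all n.-unity_root r by apply/allP=> z; rewrite -root_prod_XsubC -Dp.
have sz_r : (n < (size r).+1)%N.
  by rewrite -(size_prod_XsubC r id) -Dp size_XnsubC.
have [|z _ ?] := hasP (has_prim_root n_gt0 rn1 _ sz_r); last by exists z.
by rewrite -separable_prod_XsubC -Dp separable_Xn_sub_1 // pnatr_eq0 -lt0n.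
Qed.

Lemma sum_unity_root n (z : C) : z ^+ n = 1 -> z != 1 -> \sum_(i < n) z ^+ i = 0.
Proof.
move=> zn z1; have := subrX1 z n; rewrite zn subrr => /esym/eqP.
by rewrite mulf_eq0 subr_eq0 (negPf z1) => /eqP.
Qed.

(* The columns of W are the Fourier vectors of frequency 1, ..., t, a maximal
   isotropic subspace of the orthogonal complement of the constant vector u. *)
Lemma sign_separating_odd t : exists W : 'M[C]_(t + t.+1, t), sign_separating W.
Proof.
rewrite -addn1; set n := (t + _)%N; have n0 : (0 < n)%N by rewrite /n !addn1 addnS.
have [w w_prim] := prim_root_exists n0; have wn := prim_expr_order w_prim.
have [s [sc s2]] := sqrtC_nat_inv n0.
(* From w^n = 1 follows |w| = 1, so conjugation inverts [w]. *)
have wc : w^* * w = 1.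
  rewrite mulrC -normCK; apply/eqP; rewrite sqrp_eq1 ?normr_ge0 //.
  by rewrite -(@eqrXn2 _ n) ?normr_ge0 // -?normrX ?wn ?normr1 ?expr1n.
pose W : 'M[C]_(n, t) := \matrix_(x, k) (s * (w ^+ k.+1) ^+ x).
pose u : 'M[C]_(n, 1) := const_mx s.
have sum0 (c : C) z : z ^+ n = 1 -> z != 1 -> \sum_(x < n) c * z ^+ x = 0.
  by move=> zn z1; rewrite -mulr_sumr sum_unity_root ?mulr0.
have w_expr_neq1 k : (0 < k < n)%N -> w ^+ k != 1.
  move=> /andP[k0 kn]; rewrite -(prim_order_dvd w_prim).
  by apply/negP => /dvdn_leq; rewrite k0 leqNgt kn => /(_ isT).
have wXn k : (w ^+ k) ^+ n = 1 by rewrite exprAC wn expr1n.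
have WW : adjmx W *m W = 1%:M.
  apply/matrixP => k l; rewrite !mxE.
  under eq_bigr do rewrite !mxE rmorphM rmorphXn /= sc mulrACA -expr2 -exprMn.
  case: eqP => [->|/eqP kl].
    rewrite rmorphXn /= -exprMn wc expr1n; under eq_bigr do rewrite expr1n.
    by rewrite sumr_const card_ord mulr1 -mulr_natr s2.
  rewrite sum0 //.
    by rewrite exprMn rmorphXn /= exprAC -rmorphXn /= wn wXn rmorph1 expr1n mulr1.
  apply: contra kl => /eqP /(congr1 ( *%R (w ^+ k.+1))).
  rewrite mulrA rmorphXn /= -exprMn [w * _]mulrC wc expr1n mul1r mulr1 => /eqP.
  rewrite (eq_prim_root_expr w_prim) !modn_small; first by rewrite eqSS eq_sym.
    by have := ltn_ord k; rewrite /n; lia.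
  by have := ltn_ord l; rewrite /n; lia.
(* Two frequencies add up to at least 2 and at most 2t < n, hence never to 0 modulo [n]. *)
have WTW : W^T *m W = 0.
  apply/matrixP => k l; rewrite !mxE.
  under eq_bigr do rewrite !mxE mulrACA -expr2 -exprMn -exprD.
  rewrite sum0 // w_expr_neq1 //.
  by have := ltn_ord l; have := ltn_ord k; rewrite /n; lia.
have uW : u^T *m W = 0.
  apply/matrixP => k l; rewrite !mxE.
  under eq_bigr do rewrite !mxE mulrA -expr2.
  rewrite sum0 // w_expr_neq1 //.
  by have := ltn_ord l; rewrite /n; lia.
have ua : adjmx u = u^T by apply/matrixP => i j; rewrite !mxE sc.
have uu : adjmx u *m u = 1%:M.
  apply/matrixP => k l; rewrite !ord1 !mxE.
  under eq_bigr do rewrite !mxE sc -expr2.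
  by rewrite sumr_const card_ord -mulr_natr s2.
have Wu : adjmx W *m u = 0.
  by rewrite -[LHS]adjmxK adjmx_mul adjmxK ua uW adjmx0.
have WTu : W^T *m u = 0 by rewrite -[LHS]trmxK trmx_mul trmxK uW trmx0.
have gu (g : 'S_n) : perm_mx g *m u = u.
  by apply/matrixP => i j; rewrite perm_mx_mulE !mxE.
exists W; split=> // g.
(* Here [Y] is [W] with the invariant vector [u] appended. Since [g] fixes [u], the compression to
   [Y] is block triangular with corner 1 and has the same determinant as the compression to [W]. *)
apply: (@odd_det_compress t (t + 1) W (row_mx W u)) => //.
- by rewrite adjmx_row mul_col_row WW uu Wu ua uW -scalar_mx_block.
- by rewrite mul_mx_row WTW WTu row_mx0.
rewrite adjmx_row mul_col_mx mul_col_row -!(mulmxA _ _ u) gu Wu uu.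
by rewrite det_lblock det1 mulr1.
Qed.

Lemma sign_separating_exists n : exists W : 'M[C]_(n, n./2), sign_separating W.
Proof.
have := odd_double_half n; set t := n./2; rewrite -addnn.
case: (odd n) => /= <-; rewrite ?add0n; last exact: sign_separating_even.
rewrite add1n -addnS; exact: sign_separating_odd.
Qed.

End Isotropic.

(** * Separating orthogonal families by a projection *)

Section Measurement.
Variable C : numClosedFieldType.

Lemma adj_mul_eq0 m (x : 'cV[C]_m) : adjmx x *m x = 0 -> x = 0.
Proof.
move/matrixP/(_ 0 0); rewrite !mxE => /eqP.
rewrite psumr_eq0 => [/allP x0|i _]; last by rewrite adjmxE mulrC -normCK exprn_ge0.
apply/matrixP => i j; rewrite ord1 mxE; have := x0 i (mem_index_enum i).
by rewrite /= adjmxE mulrC -normCK expf_eq0 normr_eq0 => /eqP.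
Qed.

(** If [v] annihilates the Gram matrix, then [B *m adjmx v] has norm zero, and independence of the
    columns forces [v = 0]. *)
Lemma gram_unit m r (B : 'M[C]_(m, r)) : row_free B^T -> adjmx B *m B \in unitmx.
Proof.
move=> freeB; rewrite -row_free_unit; apply: inj_row_free => v vG.
have Bv : B *m adjmx v = 0.
  by apply: adj_mul_eq0; rewrite adjmx_mul adjmxK mulmxA -(mulmxA v) vG mul0mx.
suff /(congr1 (@adjmx C _ _)) : adjmx v = 0 by rewrite adjmxK adjmx0.
apply: (can_inj (@trmxK _ _ _)); apply: (row_free_inj freeB).
by rewrite /= -trmx_mul Bv !trmx0 mul0mx.
Qed.

(** With [B] a basis of the column space of [A], the projector is [B *m invmx G *m adjmx B] for the
    Gram matrix [G]. The transposes appear because [row_base] works with row spaces. *)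
Lemma orthogonal_projector m p (A : 'M[C]_(m, p)) : exists P : 'M[C]_m,
  [/\ adjmx P = P, P *m P = P, P *m A = A
    & forall w : 'cV[C]_m, adjmx A *m w = 0 -> P *m w = 0].
Proof.
pose B := (row_base A^T)^T; pose G := adjmx B *m B.
have Gu : G \in unitmx by rewrite gram_unit // trmxK row_base_free.
have [D AD] : exists D, A = B *m D.
  have /submxP[D AD] : (A^T <= row_base A^T)%MS by rewrite eq_row_base.
  by exists D^T; rewrite -trmx_mul -AD trmxK.
have [D' BD] : exists D', B = A *m D'.
  have /submxP[D' BD] : (row_base A^T <= A^T)%MS by rewrite eq_row_base.
  by exists D'^T; rewrite /B BD trmx_mul trmxK.
have PB : B *m invmx G *m adjmx B *m B = B.
  by rewrite -!mulmxA mulVmx ?mulmx1.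
clearbody B; exists (B *m invmx G *m adjmx B); split.
- rewrite !adjmx_mul adjmxK mulmxA; congr (_ *m _ *m _).
  rewrite /adjmx map_invmx trmx_inv -/(adjmx G).
  by rewrite /G adjmx_mul adjmxK.
- by rewrite mulmxA mulmxA PB.
- by rewrite [X in _ *m X]AD mulmxA PB -AD.
- move=> w Aw; suff Bw : adjmx B *m w = 0 by rewrite -!mulmxA Bw !mulmx0.
  by rewrite BD adjmx_mul -mulmxA Aw mulmx0.
Qed.

Lemma psd_projector m (P : 'M[C]_m) : adjmx P = P -> P *m P = P -> psd P.
Proof. by move=> P1 P2; rewrite -P2 -{1}P1; apply: psd_adj_mul. Qed.

(** [Ep] projects onto the span of the vectors with [b] false; the remaining ones are orthogonal to
    that span and are fixed by [1 - Ep]. *)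
Lemma separating_povm m (I : finType) (b : pred I) (u : I -> 'cV[C]_m) :
    (forall i j, ~~ b i -> b j -> adjmx (u i) *m u j = 0) ->
  exists Ep Em : 'M[C]_m, two_povm Ep Em /\
    forall i, (if b i then Em else Ep) *m u i = u i.
Proof.
(* Zero columns stand in for the indices with [b] true, so that all of [I] indexes the columns
   without changing the span. *)
move=> uu; pose A := \matrix_(k < m, j < #|I|)
  (if b (enum_val j) then 0 else u (enum_val j) k 0).
have [P [P1 P2 PA Pw]] := orthogonal_projector A.
exists P, (1%:M - P); split; first split.
- exact: psd_projector.
- split; last by rewrite addrC subrK.
  apply: psd_projector; first by rewrite adjmxB adjmx1 P1.
  by rewrite mulmxBl mul1mx mulmxBr mulmx1 P2 subrr subr0.
move=> i; case: ifP => bi; last first.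
  suff -> : u i = col (enum_rank i) A by rewrite colE mulmxA PA.
  by apply/matrixP => k j; rewrite !mxE enum_rankK bi ord1.
rewrite mulmxBl mul1mx Pw ?subr0 //; apply/matrixP => j l; rewrite !mxE ord1.
case bj : (b (enum_val j)).
  by rewrite big1 // => k _; rewrite adjmxE mxE bj rmorph0 mul0r.
have := congr1 (fun M : 'M_1 => M 0 0) (uu (enum_val j) i (negbT bj) bi).
by rewrite !mxE => {2}<-; apply: eq_bigr => k _; rewrite !adjmxE mxE bj.
Qed.

End Measurement.

(** * Cauchy-Binet formula *)

(** Cauchy-Binet over all maps [f] rather than increasing ones: non-injective maps contribute 0 and
    each set of [t] rows is counted t! times. *)
Lemma sum_det_rowsub (R : comPzRingType) n t (A B : 'M[R]_(n, t)) :
  \sum_(f : {ffun 'I_t -> 'I_n}) \det (rowsub f A) * \det (rowsub f B) =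
  t`!%:R * \det (A^T *m B).
Proof.
transitivity (\sum_(s : 'S_t) \sum_(s' : 'S_t) (-1) ^+ odd_perm s * ((-1) ^+ odd_perm s' *
    \prod_i (A^T *m B) (s i) (s' i))).
  under eq_bigr => f _.
    rewrite mulr_suml.
    under eq_bigr => s _ do rewrite mulr_sumr.
    over.
  rewrite exchange_big; apply: eq_bigr => s _ /=.
  rewrite exchange_big; apply: eq_bigr => s' _ /=.
  under [in RHS]eq_bigr do rewrite mxE.
  rewrite bigA_distr_bigA !mulr_sumr; apply: eq_bigr => f _.
  rewrite mulrACA -mulrA; congr (_ * (_ * _)); rewrite -big_split.
  by apply: eq_bigr => i _; rewrite !mxE.
transitivity (\sum_(s : 'S_t) \det (A^T *m B)); last first.
  by rewrite sumr_const card_Sn mulr_natl.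
(* For fixed [s], the sum over [s'] is the determinant of a row permutation of [A^T *m B], and the
   two signs of [s] cancel. *)
apply: eq_bigr => s _; rewrite -mulr_sumr.
transitivity ((-1) ^+ odd_perm s * \det (row_perm s (A^T *m B))).
  congr (_ * _); rewrite /determinant; apply: eq_bigr => s' _.
  by congr (_ * _); apply: eq_bigr => i _; rewrite [RHS]mxE.
by rewrite row_permE det_mulmx det_perm mulrA -expr2 sqrr_sign mul1r.
Qed.

(** * Parallel queries simulated by cyclic rotation *)

Section CyclicAlgorithm.
Variables (C : numClosedFieldType) (n s : nat).
Notation t := s.+1.
Notation N := #|{: s.-tuple 'I_n}|.

(** The ancilla dimension [N] is n^s, so the space is the [t]-th tensor power of V with basis
    indexed by [t]-tuples; the oracle acts on the head. *)
Definition registers (k : 'I_(n * N)) : t.-tuple 'I_n :=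
  [tuple of tens_fst k :: enum_val (tens_snd k)].

Definition unregisters (z : t.-tuple 'I_n) : 'I_(n * N) :=
  tens_idx (thead z) (enum_rank [tuple of behead z]).

Lemma registersK : cancel registers unregisters.
Proof.
move=> k; rewrite /unregisters theadE -[RHS]tens_idxK; congr tens_idx.
by rewrite -[RHS]enum_valK; congr enum_rank; apply: val_inj.
Qed.

Lemma unregistersK : cancel unregisters registers.
Proof.
move=> z; rewrite [RHS]tuple_eta; apply: val_inj => /=.
by rewrite tens_fstK tens_sndK enum_rankK.
Qed.

Lemma rotate_inj : injective (fun k => unregisters [tuple of rotr 1 (registers k)]).
Proof.
move=> k l /(can_inj unregistersK)/(congr1 val)/(@rotr_inj 1 _) kl.
exact/(can_inj registersK)/val_inj.
Qed.

Definition rotate : 'S_(n * N) := perm rotate_inj.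

(** One rotation followed by one query, on plain sequences to allow induction on the length; the
    default [[::]] is reached only from the empty sequence. *)
Definition query_step (a : 'S_n) (l : seq 'I_n) :=
  if rotr 1 l is x :: l' then a x :: l' else [::].

(** Every entry passes through the head exactly once. The generalisation [step] tracks the last
    [size l2] entries as they move to the front. *)
Lemma iter_query_step a l : iter (size l) (query_step a) l = map a l.
Proof.
suff step l1 l2 : iter (size l2) (query_step a) (l1 ++ l2) = map a l2 ++ l1.
  by have := step [::] l; rewrite cats0.
elim/last_ind: l2 l1 => [|l2 x IH] l1; first by rewrite cats0.
rewrite size_rcons iterSr -rcons_cat /query_step rotr1_rcons -/(query_step a).
by rewrite -cat_cons IH map_rcons cat_rcons.
Qed.

Lemma registers_step a k :
  registers (tens_perm N a (rotate k)) = query_step a (registers k) :> seq _.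
Proof.
have rk : registers (rotate k) = rotr 1 (registers k) :> seq _.
  by rewrite permE unregistersK.
by rewrite /query_step -rk permE /= tens_fstK tens_sndK.
Qed.

(** A permutation matrix acts on a column by substitution in the index, so the leftmost factor acts
    on the index first. *)
Lemma run_perm (c q : 'S_(n * N)) psi j k :
  run (fun=> perm_mx c : 'M[C]_(n * N)) (perm_mx q) psi j k 0 =
  psi (iter j (fun k => q (c k)) k) 0.
Proof. by elim: j k => //= j IH k; rewrite !perm_mx_mulE IH -iterSr. Qed.

Definition rotations := fun _ : nat => perm_mx rotate : 'M[C]_(n * N).

(** After [t] rounds every register has been queried once: pi(a) has acted on all tensor factors. *)
Lemma state_of_rotations psi a k :
  state_of t psi rotations a k 0 =
  psi (unregisters [tuple of map a (registers k)]) 0.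
Proof.
have step j : registers (iter j (fun k => tens_perm N a (rotate k)) k) =
    iter j (query_step a) (registers k) :> seq _.
  by elim: j => // j IH; rewrite !iterS registers_step IH.
rewrite /state_of kron_perm run_perm; congr (psi _ 0).
apply: (can_inj registersK); rewrite unregistersK; apply: val_inj.
by rewrite [LHS]step -[RHS]/(map a (registers k)) -iter_query_step size_tuple.
Qed.

Variable W : 'M[C]_(n, t).

(* The normalised exterior product of the columns of W, inside the t-th tensor
   power of V: its coordinates are the maximal minors of W. *)
Definition wedge : 'cV[C]_(n * N) :=
  \col_k ((sqrtC t`!%:R)^-1 * \det (rowsub (tnth (registers k)) W)).

Lemma state_of_wedge a k : state_of t wedge rotations a k 0 =
  (sqrtC t`!%:R)^-1 * \det (rowsub (tnth (registers k)) (perm_mx a *m W)).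
Proof.
rewrite state_of_rotations mxE unregistersK; congr (_ * \det _).
by apply/matrixP => i j; rewrite [LHS]mxE [RHS]mxE perm_mx_mulE tnth_map.
Qed.

(** Cauchy-Binet evaluates the sum of products of minors, and its factor t! cancels the
    normalisation. *)
Lemma overlap_wedge a b :
  (adjmx (state_of t wedge rotations a) *m state_of t wedge rotations b) 0 0 =
  \det (adjmx W *m perm_mx (a^-1 * b) *m W).
Proof.
set A := map_mx Num.conj (perm_mx a *m W); set B := perm_mx b *m W.
have t0 : (t`!%:R : C) != 0 by rewrite pnatr_eq0 -lt0n fact_gt0.
(* Basis states are relabelled by the maps from ['I_t] to ['I_n]. *)
rewrite mxE (reindex (fun f : {ffun 'I_t -> 'I_n} => unregisters (mktuple f))) /=; last first.
  exists (fun k => finfun (tnth (registers k))) => [f|k] _.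
    by apply/ffunP => i; rewrite ffunE unregistersK tnth_mktuple.
  rewrite -[RHS]registersK; congr unregisters; apply: eq_from_tnth => i.
  by rewrite tnth_mktuple ffunE.
transitivity (\sum_(f : {ffun 'I_t -> 'I_n})
    t`!%:R^-1 * (\det (rowsub f A) * \det (rowsub f B))).
  apply: eq_bigr => f _; rewrite adjmxE !state_of_wedge rmorphM /= -det_map_mx.
  rewrite unregistersK geC0_conj ?invr_ge0 ?sqrtC_ge0 ?ler0n // mulrACA -expr2.
  have rowsub_f (M : 'M[C]_(n, t)) : rowsub (tnth (mktuple f)) M = rowsub f M.
    by apply/matrixP => i j; rewrite !mxE tnth_mktuple.
  by rewrite exprVn sqrtCK !rowsub_f map_mxsub.
rewrite -mulr_sumr sum_det_rowsub mulrA mulVf // mul1r; congr (\det _).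
rewrite /A -/(adjmx _) adjmx_mul adjmx_perm /B.
by rewrite perm_mxM !mulmxA.
Qed.

End CyclicAlgorithm.

(** * Assembling the two bounds *)

Lemma exact_algorithm (C : numClosedFieldType) n t : (0 < t)%N ->
    (exists W : 'M[C]_(n, t), sign_separating W) ->
  exists N (psi : 'cV[C]_(n * N)) (U : nat -> 'M[C]_(n * N)) (Ep Em : 'M[C]_(n * N)),
    is_query_alg t psi U Ep Em /\ success t psi U Ep Em = 1.
Proof.
case: t => // s _ [W [WW Wodd]]; pose psi := wedge W; pose U := rotations C n s.
have Uu i : unitary (U i) by apply: unitary_perm.
have norm1 a : adjmx (state_of s.+1 psi U a) *m state_of s.+1 psi U a = 1%:M.
  apply/matrixP => i j; rewrite !ord1 overlap_wedge mulVg perm_mx1 mulmx1 WW.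
  by rewrite det1 mxE.
have [Ep [Em [E E1]]] : exists Ep Em : 'M[C]_(n * _), two_povm Ep Em /\
    forall a : 'S_n, (if odd_perm a then Em else Ep) *m state_of s.+1 psi U a
      = state_of s.+1 psi U a.
  apply: separating_povm => a b a0 b1; apply/matrixP => i j.
  by rewrite !ord1 overlap_wedge mxE Wodd // odd_permM odd_permV (negPf a0) b1.
have N0 : (0 < #|{: s.-tuple 'I_n}|)%N.
  rewrite card_tuple card_ord expn_gt0.
  (* For n = 0 the identity [adjmx W *m W = 1%:M], of positive size, would read 0 = 1. *)
  case: (posnP n) W WW {Wodd psi U Uu norm1 Ep Em E E1} => [->|//] W.
  by move/matrixP/(_ 0 0); rewrite !mxE big_ord0 => /eqP; rewrite eq_sym oner_eq0.
exists #|{: s.-tuple 'I_n}|, psi, U, Ep, Em; split.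
  split=> //; split; last by [].
  have := norm1 1%g; rewrite /state_of run_norm //; last exact: unitary_kron_perm.
  by move=> psi1; rewrite /unit_vec psi1 mxE.
have n0 : (n`!%:R : C) != 0 by rewrite pnatr_eq0 -lt0n fact_gt0.
rewrite /success.
under eq_bigr do rewrite -mulmxA E1 norm1 mxE /=.
by rewrite sumr_const card_Sn mulVf.
Qed.

(** Below the threshold every algorithm succeeds with probability 1/2, so any one attains the
    optimum; this one applies identities and always answers +1. *)
Lemma trivial_query_alg (C : numClosedFieldType) n t : (0 < n)%N ->
  exists N (psi : 'cV[C]_(n * N)) (U : nat -> 'M[C]_(n * N)) (Ep Em : 'M[C]_(n * N)),
    is_query_alg t psi U Ep Em.
Proof.
case: n => // n _; exists 1%N, (delta_mx 0 0), (fun=> 1%:M), 1%:M, 0.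
split=> //; split; last split.
- rewrite /unit_vec mxE (bigD1 0) //= adjmxE !mxE !eqxx rmorph1 mulr1 big1 ?addr0 //.
  by move=> i /negPf i0; rewrite !mxE i0 mulr0.
- by move=> i _; apply: unitary1.
- by split; [apply: psd1 | split; [apply: psd0 | rewrite addr0]].
Qed.

Theorem theorem21 (C : numClosedFieldType) (n : nat) (hn : (2 <= n)%N) :
  (exists (N : nat) (psi : 'cV[C]_(n * N)) (U : nat -> 'M[C]_(n * N)) (Ep Em : 'M[C]_(n * N)),
      is_query_alg (n./2) psi U Ep Em /\ success (n./2) psi U Ep Em = 1)
  /\
  (forall t : nat, (t < n./2)%N ->
     (forall (N : nat) (psi : 'cV[C]_(n * N)) (U : nat -> 'M[C]_(n * N)) (Ep Em : 'M[C]_(n * N)),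
        is_query_alg t psi U Ep Em -> success t psi U Ep Em <= 2^-1)
     /\
     (exists (N : nat) (psi : 'cV[C]_(n * N)) (U : nat -> 'M[C]_(n * N)) (Ep Em : 'M[C]_(n * N)),
        is_query_alg t psi U Ep Em /\ success t psi U Ep Em = 2^-1)).
Proof.
split.
  by apply: exact_algorithm; [rewrite half_gt0 | apply: sign_separating_exists].
move=> t tn; split=> [N psi U Ep Em /(success_half tn)-> //|].
have [N [psi [U [Ep [Em alg]]]]] := @trivial_query_alg C n t (ltnW hn).
by exists N, psi, U, Ep, Em; split=> //; apply: success_half.
Qed.
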